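(* Let $B=(b_{s,i})$ be an $m\times n$ matrix with entries in $[k]=\{1,\dots,k\}$ that encodes an uncertain set system: its rows $s\in[m]$ represent the sets (drawn as set curves), its columns $i\in[n]$ represent the elements, and the columns are arranged according to a given element order. For this given element order, the curve ordering algorithm described in the context computes an order $\Lambda=(\lambda_1,\dots,\lambda_n)$ of the set curves with the minimum number of crossings. The algorithm runs in $O(nm\log m)$ time.
   Context: Setting. An uncertain set system has $n$ elements, $m$ sets, and uncertainty levels $0=l_1<l_2<\dots<l_k=1$; each element $u_i$ is contained in each set $s$ with a certainty $\beta(s,u_i)\in\{l_1,\dots,l_k\}$. It is encoded by the matrix $B$, where $b_{s,i}=p$ means $\beta(s,u_i)=l_p$; one says that set $s$ is in bin $p$ of element $i$. The elements are drawn as vertical markers from left to right in the given element order, which is not changed, and the columns of $B$ are arranged in that order. Orders of the set curves. An order of the set curves is a tuple $\Lambda=(\lambda_1,\dots,\lambda_n)$, where $\lambda_i\colon[m]\to[m]$ represents the vertical order of the set curves at element $i$: $\lambda_i(s)$ is the position of the curve of set $s$, and $\lambda_i(s)<\lambda_i(s')$ means that $s$ is below $s'$ at element $i$. Each $\lambda_i$ is a bijection and respects the bins, that is, $b_{s,i}<b_{s',i}$ implies $\lambda_i(s)<\lambda_i(s')$; curves in the same bin of an element may be ordered freely among each other. The minimum is over all such $\Lambda$. Crossings. The curve of set $s$ is the polyline $\langle\lambda_1(s),\dots,\lambda_n(s)\rangle$, which bends only at the element markers. For two distinct sets $s,s'$ and $1\le i<n$, the curves $s$ and $s'$ cross between elements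 $i$ and $i+1$ if $\lambda_i(s)<\lambda_i(s')$ and $\lambda_{i+1}(s)>\lambda_{i+1}(s')$, or vice versa. The number of crossings is the total number of such crossings over all pairs of curves and all pairs of consecutive elements. The curve ordering algorithm. 1. Kernelization: if two or more curves have the same bin assignment for all elements (identical rows of $B$), keep only one representative for this subset of the curves. 2. First element: for two remaining curves $s,s'$, compute (in $O(n)$ time) the first index $1\le j\le n$ with $b_{s,j}\ne b_{s',j}$. If $b_{s,j}<b_{s',j}$, place $s$ below $s'$ in $\lambda_1$; otherwise place $s$ above $s'$. Sorting the curves by these precedences yields $\lambda_1$; this is done with HeapSort, computing only the necessary precedences on the fly. 3. Remaining elements $i=2,\dots,n$, in order: for two curves $s,s'$, if $b_{s,i}\ne b_{s',i}$, the curve in the lower bin is lower in $\lambda_i$; otherwise $s$ and $s'$ are left in the same relative order as in $\lambda_{i-1}$. Sorting the curves by these precedences, in $O(m\log m)$ time, yields $\lambda_i$. 4. Finally, insert all curves that were removed in the kernelization, each in the order directly below its representative. *)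

(* Defs.v *)
From HB Require Import structures.
From mathcomp Require Import all_boot all_order all_fingroup all_algebra.

Set Implicit Arguments.
Unset Strict Implicit.
Unset Printing Implicit Defensive.

(* Elements, sets, bins and positions are numbered from 0. *)

Record uncertain_set_system (R : realFieldType) (m n k : nat) := {
  level : 'I_k -> R;
  level_increasing :
    forall p q : 'I_k, (p < q)%N -> (level p < level q)%R;
  level_first : exists2 p : 'I_k, p = 0 :> nat & level p = 0%R;
  level_last : exists2 p : 'I_k, p.+1 = k & level p = 1%R;
  certainty : 'I_m -> 'I_n -> R;
  certainty_level : forall s i, exists p, certainty s i = level p
}.

Definition encodes (R : realFieldType) (m n k : nat)
    (U : uncertain_set_system R m n k) (B : 'M['I_k]_(m, n)) : Prop :=
  forall s i, certainty U s i = level U (B s i).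

Definition curve_order (m n : nat) := 'I_n -> 'S_m.

Definition respects_bins (m n k : nat) (B : 'M['I_k]_(m, n))
    (L : curve_order m n) : Prop :=
  forall (i : 'I_n) (s s' : 'I_m), B s i < B s' i -> L i s < L i s'.

Definition cross (m n : nat) (L : curve_order m n) (i j : 'I_n)
    (s s' : 'I_m) : bool :=
  (L i s < L i s') && (L j s > L j s') ||
  (L i s > L i s') && (L j s < L j s').

Definition crossings (m n : nat) (L : curve_order m n) : nat :=
  \sum_(i < n) \sum_(j < n | j == i.+1 :> nat)
    \sum_(s < m) \sum_(s' < m | s < s') cross L i j s s'.

Definition min_crossings (m n k : nat) (B : 'M['I_k]_(m, n))
    (L : curve_order m n) : Prop :=
  respects_bins B L /\
  forall L', respects_bins B L' -> crossings L <= crossings L'.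

(* The memory consists of named arrays of words.  Besides the input and the
   output, the arrays hold the following data (a "kept" curve is one that
   survives the kernelization):
   - [SORTED]: all curves, grouped by identical rows;
   - [KEPT]: the kept curves;
   - [FIRST], [LAST]: a kept curve [r] represents the curves stored in the cells
     [FIRST r <= p < LAST r] of [SORTED], the first of which is [r] itself;
   - [KORDER i]: the kept curves from bottom to top at element [i];
   - [KPOS i]: the inverse of [KORDER i]. *)
Inductive array :=
  | BINS (s : nat)
  | SORTED | KEPT | FIRST | LAST
  | KORDER (i : nat)
  | KPOS (i : nat)
  | LAMBDA (i : nat).

Definition array_code (a : array) : nat * nat :=
  match a with
  | BINS s => (0, s)
  | SORTED => (1, 0) | KEPT => (2, 0) | FIRST => (3, 0) | LAST => (4, 0)
  | KORDER i => (5, i)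
  | KPOS i => (6, i)
  | LAMBDA i => (7, i)
  end.

Definition array_decode (c : nat * nat) : option array :=
  match c with
  | (0, s) => Some (BINS s)
  | (1, _) => Some SORTED | (2, _) => Some KEPT
  | (3, _) => Some FIRST | (4, _) => Some LAST
  | (5, i) => Some (KORDER i)
  | (6, i) => Some (KPOS i)
  | (7, i) => Some (LAMBDA i)
  | _ => None
  end.

Lemma array_codeK : pcancel array_code array_decode.
Proof. by case. Qed.

HB.instance Definition _ := Equality.copy array (pcan_type array_codeK).

Definition memory := array -> nat -> nat.

Record outcome (A : Type) := Outcome {
  value : A;
  final_memory : memory;
  time : nat
}.

Definition program (A : Type) := memory -> outcome A.

Definition ret (A : Type) (x : A) : program A := fun M => Outcome x M 0.

Definition bind (A A' : Type) (c : program A) (f : A -> program A') :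
    program A' := fun M =>
  let: Outcome x M1 t1 := c M in
  let: Outcome y M2 t2 := f x M1 in
  Outcome y M2 (t1 + t2).

Notation "'let!' x := c 'in' d" := (bind c (fun x => d))
  (at level 200, x name, d at level 200).
Notation "c ;; d" := (bind c (fun _ => d))
  (at level 199, d at level 200).

(* Unit-cost random access machine: each instruction takes one time unit.
   Registers are variables of the metalanguage.  [calc e] evaluates [e], which
   must be an arithmetic expression or test of fixed size on registers; the
   operands of [read] and [write] may likewise be such expressions. *)
Definition calc (A : Type) (e : A) : program A := fun M => Outcome e M 1.

Definition read (a : array) (j : nat) : program nat :=
  fun M => Outcome (M a j) M 1.

Definition write (a : array) (j v : nat) : program unit := fun M =>
  Outcome tt (fun a' j' => if (a' == a) && (j' == j) then v else M a' j') 1.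

(* Runs [body i] for i = lo, ..., lo + cnt - 1; every evaluation of the loop
   condition takes one time unit. *)
Fixpoint for_up (A : Type) (lo cnt : nat) (acc : A)
    (body : nat -> A -> program A) : program A :=
  calc tt ;;
  if cnt is cnt'.+1 then
    let! acc' := body lo acc in for_up lo.+1 cnt' acc' body
  else ret acc.

(* Runs [body i] for i = cnt - 1, ..., 0. *)
Fixpoint for_down (cnt : nat) (body : nat -> program unit) : program unit :=
  calc tt ;;
  if cnt is cnt'.+1 then body cnt' ;; for_down cnt' body else ret tt.

(* Restores the max-heap property at node [r] in the first [h] cells of [a].
   [fuel] only serves to make the recursion structural; [fuel = h] suffices. *)
Fixpoint sift_down (below : nat -> nat -> program bool) (a : array) (h : nat)
    (fuel r : nat) : program unit :=
  if fuel is fuel'.+1 then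
    let! c := calc (2 * r).+1 in
    let! has_child := calc (c < h) in
    if has_child then
      let! x := read a c in
      let! two_children := calc (c.+1 < h) in
      let! d := (if two_children then
                   let! y := read a c.+1 in
                   let! right_larger := below x y in
                   calc (if right_larger then c.+1 else c)
                 else ret c) in
      let! v := read a r in
      let! w := read a d in
      let! b := below v w in
      if b then write a r w ;; write a d v ;; sift_down below a h fuel' d
      else ret tt
    else ret tt
  else ret tt.

(* In place, with a binary max-heap in the first [h] cells of [a]; the precedences
   [below] are computed on the fly. *)
Definition heap_sort (below : nat -> nat -> program bool) (a : array)
    (h : nat) : program unit :=
  let! parents := calc h./2 in
  for_down parents (fun r => sift_down below a h h r) ;;
  let! rounds := calc h.-1 in
  for_down rounds (fun e =>
    let! x := read a 0 in
    let! y := read a e.+1 in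
    write a 0 y ;; write a e.+1 x ;;
    sift_down below a e.+1 e.+1 0).

(* First index [j' >= j] at which the rows [s] and [s'] differ, or [j + cnt] if
   they agree at [j, ..., j + cnt - 1]. *)
Fixpoint first_difference (s s' j cnt : nat) : program nat :=
  calc tt ;;
  if cnt is cnt'.+1 then
    let! x := read (BINS s) j in
    let! y := read (BINS s') j in
    let! same := calc (x == y) in
    if same then first_difference s s' j.+1 cnt' else ret j
  else ret j.

Definition below_first (n s s' : nat) : program bool :=
  let! j := first_difference s s' 0 n in
  let! differ := calc (j < n) in
  if differ then
    let! x := read (BINS s) j in
    let! y := read (BINS s') j in
    calc (x < y)
  else ret false.

Definition below_next (i s s' : nat) : program bool :=
  let! x := read (BINS s) i in
  let! y := read (BINS s') i in
  let! same := calc (x == y) in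
  if same then
    let! p := read (KPOS i.-1) s in
    let! p' := read (KPOS i.-1) s' in
    calc (p < p')
  else calc (x < y).

Definition copy (a a' : array) (h : nat) : program unit :=
  for_up 0 h tt (fun p _ => let! s := read a p in write a' p s).

Definition record_positions (i h : nat) : program unit :=
  for_up 0 h tt (fun p _ =>
    let! s := read (KORDER i) p in write (KPOS i) s p).

(* Identical rows become adjacent when the rows are sorted lexicographically.
   Returns the number of kept curves; the loop maintains this number and the
   last kept curve. *)
Definition kernelize (n m : nat) : program nat :=
  for_up 0 m tt (fun s _ => write SORTED s s) ;;
  heap_sort (below_first n) SORTED m ;;
  let! qr := for_up 0 m (0, 0) (fun p qr =>
    let: (q, r) := qr in
    let! s := read SORTED p in
    let! is_first := calc (p == 0) in
    let! is_new := (if is_first then ret true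
                    else let! j := first_difference r s 0 n in
                         calc (j < n)) in
    if is_new then
      write KEPT q s ;; write FIRST s p ;; write LAST s p.+1 ;;
      calc (q.+1, s)
    else (write LAST r p.+1 ;; ret (q, r))) in
  ret qr.1.

Definition order_first (n q : nat) : program unit :=
  copy KEPT (KORDER 0) q ;;
  heap_sort (below_first n) (KORDER 0) q ;;
  record_positions 0 q.

Definition order_next (i q : nat) : program unit :=
  copy (KORDER i.-1) (KORDER i) q ;;
  heap_sort (below_next i) (KORDER i) q ;;
  record_positions i q.

(* Emits all curves at element [i] from bottom to top, those removed by the
   kernelization directly below their representative; the accumulator is the
   next free position. *)
Definition reinsert (i q : nat) : program nat :=
  for_up 0 q 0 (fun p pos =>
    let! r := read (KORDER i) p in
    let! lo := read FIRST r in
    let! hi := read LAST r in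
    let! removed := calc (hi - lo.+1) in
    let! pos' := for_up lo.+1 removed pos (fun j pos =>
      let! s := read SORTED j in
      write (LAMBDA i) s pos ;;
      calc pos.+1) in
    write (LAMBDA i) r pos' ;;
    calc pos'.+1).

Definition curve_ordering (n m : nat) : program unit :=
  let! q := kernelize n m in
  order_first n q ;;
  for_up 1 n.-1 tt (fun i _ => order_next i q) ;;
  for_up 0 n tt (fun i _ => reinsert i q ;; ret tt).

(* The memory cells outside of the input array are not initialised. *)
Definition holds_input (m n k : nat) (B : 'M['I_k]_(m, n)) (M : memory) :
    Prop :=
  forall (s : 'I_m) (i : 'I_n), M (BINS s) i = B s i.

Definition holds_output (m n : nat) (L : curve_order m n) (M : memory) : Prop :=
  forall (i : 'I_n) (s : 'I_m), M (LAMBDA i) s = L i s.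

(* Main.v *)
Require Import Defs.
From HB Require Import structures.
From mathcomp Require Import all_boot all_order all_fingroup all_algebra.
From mathcomp Require Import zify.

(* Optimality is a statement about one pair of curves at a time.  Between two
   elements the algorithm swaps a pair only when the bins of the right element
   force it, and before the first element that distinguishes the pair it never
   swaps.  So from that element on the following is invariant for any competing
   order: the crossings so far, plus one if the algorithm and the competitor
   currently disagree on the pair, are at most the crossings of the competitor.

   All comparisons of the program come from keys in total orders (rows compared
   lexicographically; pairs of bin and previous position), so one analysis of
   heapsort serves the kernelization and every element. *)

Import Order.TTheory.

Set Implicit Arguments.
Unset Strict Implicit.
Unset Printing Implicit Defensive.

(** * Time-bounded triples *)

(** A lexicographic comparison of two rows costs O(n), which is affordable because only two sorts
    use it: the one that groups identical rows and the one at the first element. Every later sort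
    compares in constant time, since the previous order is available through its inverse [KPOS].
    Both kinds of work add up to O(nm log m).

    A pair that no element distinguishes has identical rows and lies outside the invariant. Its
    curves never cross, because reinsertion emits the same block of curves, in the same internal
    order, at every element.

    Programs are functions on memory that also return their time, so correctness and cost are proved
    together. Since the phases share one memory, each specification also records which arrays it
    leaves unchanged; that is how keys are known to survive a sort and groups to survive all later
    phases. *)

Definition runs (A : Type) (c : program A) (M : memory) (T : nat)
    (Q : A -> memory -> Prop) : Prop :=
  Q (value (c M)) (final_memory (c M)) /\ time (c M) <= T.

Definition upd (M : memory) (a : array) (j v : nat) : memory :=
  fun a' j' => if (a' == a) && (j' == j) then v else M a' j'.

Lemma updE M a j v j' : upd M a j v a j' = if j' == j then v else M a j'.
Proof. by rewrite /upd eqxx. Qed.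

Lemma upd_neq M a j v b : b != a -> upd M a j v b =1 M b.
Proof. by rewrite /upd => /negbTE ->. Qed.

Lemma runs_weaken A (c : program A) M T1 T2 (Q1 Q2 : A -> memory -> Prop) :
  runs c M T1 Q1 -> T1 <= T2 -> (forall x M', Q1 x M' -> Q2 x M') ->
  runs c M T2 Q2.
Proof. by case=> q t le12 q12; split; [exact: q12 | exact: leq_trans le12]. Qed.

(** The unspent budget [T - T1] is handed to the continuation, so a program can be stepped through
    from the front with only linear side conditions on the budget. *)
Lemma runs_bind A A' (c : program A) (f : A -> program A') M T1 T P Q :
  runs c M T1 P -> T1 <= T ->
  (forall x M', P x M' -> runs (f x) M' (T - T1) Q) ->
  runs (bind c f) M T Q.
Proof.
rewrite /runs /bind; case: (c M) => x M1 t1 /= [p t1T1] T1T /(_ _ _ p).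
case: (f x M1) => y M2 t2 /= [q t2T]; split=> //; lia.
Qed.

Lemma runs_ret A (x : A) M T (Q : A -> memory -> Prop) :
  Q x M -> runs (ret x) M T Q.
Proof. by []. Qed.

Lemma runs_calc A (x : A) M T (Q : A -> memory -> Prop) :
  0 < T -> Q x M -> runs (calc x) M T Q.
Proof. by []. Qed.

Lemma runs_calc_bind A A' (x : A) (f : A -> program A') M T Q :
  0 < T -> runs (f x) M T.-1 Q -> runs (bind (calc x) f) M T Q.
Proof.
move=> T0 r; apply: (@runs_bind _ _ _ _ _ 1 _ (fun y M' => y = x /\ M' = M)) => //.
by move=> y M' [-> ->]; rewrite subn1.
Qed.

Lemma runs_read_bind A' a j (f : nat -> program A') M T Q :
  0 < T -> runs (f (M a j)) M T.-1 Q -> runs (bind (read a j) f) M T Q.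
Proof.
move=> T0 r.
apply: (@runs_bind _ _ _ _ _ 1 _ (fun y M' => y = M a j /\ M' = M)) => //.
by move=> y M' [-> ->]; rewrite subn1.
Qed.

Lemma runs_write a j v M T (Q : unit -> memory -> Prop) :
  0 < T -> Q tt (upd M a j v) -> runs (write a j v) M T Q.
Proof. by []. Qed.

Lemma runs_write_bind A' a j v (f : unit -> program A') M T Q :
  0 < T -> runs (f tt) (upd M a j v) T.-1 Q -> runs (bind (write a j v) f) M T Q.
Proof.
move=> T0 r.
apply: (@runs_bind _ _ _ _ _ 1 _ (fun _ M' => M' = upd M a j v)) => //.
by case=> M' ->; rewrite subn1.
Qed.

(** The bound of the body may depend on the index: in [reinsert] one iteration can be as expensive
    as all others together, and only the sum is small. The [cnt.+1] counts the evaluations of the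
    loop condition. *)
Lemma runs_for_up A (body : nat -> A -> program A) (T : nat -> nat)
    (I : nat -> A -> memory -> Prop) lo cnt x M :
  I lo x M ->
  (forall i y M', lo <= i < lo + cnt -> I i y M' ->
     runs (body i y) M' (T i) (I i.+1)) ->
  runs (for_up lo cnt x body) M (cnt.+1 + \sum_(lo <= i < lo + cnt) T i)
    (I (lo + cnt)).
Proof.
elim: cnt lo x M => [|cnt IH] lo x M I0 step /=.
  by apply: runs_calc_bind => //; apply: runs_ret; rewrite addn0.
rewrite big_ltn; last lia.
apply: runs_calc_bind; first lia.
apply: (runs_bind (step _ _ _ _ I0)); [lia | lia |].
move=> y M' I1; rewrite -addSnnS.
apply: (runs_weaken (IH _ _ _ I1 _)) => // [i z M2 le_i|].
  by apply: step; lia.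
by rewrite addSnnS; lia.
Qed.

Lemma runs_for_up_const A (body : nat -> A -> program A) T
    (I : nat -> A -> memory -> Prop) lo cnt x M :
  I lo x M ->
  (forall i y M', lo <= i < lo + cnt -> I i y M' ->
     runs (body i y) M' T (I i.+1)) ->
  runs (for_up lo cnt x body) M (1 + cnt * T.+1) (I (lo + cnt)).
Proof.
move=> I0 step; apply: (runs_weaken (runs_for_up I0 step)) => //.
by rewrite sum_nat_const_nat addKn mulnS.
Qed.

Lemma runs_for_down (body : nat -> program unit) T (I : nat -> memory -> Prop)
    cnt M :
  I cnt M ->
  (forall e M', e < cnt -> I e.+1 M' ->
     runs (body e) M' T (fun _ => I e)) ->
  runs (for_down cnt body) M (1 + cnt * T.+1) (fun _ => I 0).
Proof.
elim: cnt M => [|cnt IH] M I0 step /=.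
  exact: runs_calc_bind.
apply: runs_calc_bind => //.
apply: (runs_bind (step _ _ _ I0)) => //; first lia.
move=> _ M' I1; apply: (runs_weaken (IH _ I1 _)) => //; last lia.
by move=> e M2 le_e; apply: step; lia.
Qed.

(** The frame condition of a phase. Memories are functions, so agreement is pointwise. *)
Definition same_except (bs : seq array) (M M' : memory) : Prop :=
  forall b, b \notin bs -> M' b =1 M b.

(** * Heapsort *)

(** The second half matters in heapsort: sifting in a shrinking heap must not touch the sorted part
    behind it. *)
Definition perm_prefix (h : nat) (f g : nat -> nat) : Prop :=
  perm_eq (mkseq f h) (mkseq g h) /\ forall j, h <= j -> f j = g j.

Lemma perm_prefix_trans h g f k :
  perm_prefix h f g -> perm_prefix h g k -> perm_prefix h f k.
Proof.
move=> [p1 e1] [p2 e2]; split; first exact: perm_trans p2.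
by move=> j hj; rewrite e1 ?e2.
Qed.

Lemma perm_prefix_widen h N f g :
  h <= N -> perm_prefix h f g -> perm_prefix N f g.
Proof.
move=> hN [p e]; split; last by move=> j Nj; apply: e; lia.
rewrite /mkseq -(subnKC hN) iotaD !map_cat perm_cat // add0n.
rewrite (_ : map f (iota h _) = map g (iota h (N - h))) //.
by apply/eq_in_map => j; rewrite mem_iota => /andP[/e].
Qed.

Lemma perm_prefix_inv h f g i : perm_prefix h f g -> i < h ->
  exists2 j, j < h & f i = g j.
Proof.
move=> [p _] ih; have: f i \in mkseq g h by rewrite -(perm_mem p) map_f ?mem_iota.
by move/mapP=> [j]; rewrite mem_iota => /= jh ->; exists j.
Qed.

Lemma perm_prefix_swap h f g i j : i < h -> j < h ->
  g i = f j -> g j = f i -> (forall x, x != i -> x != j -> g x = f x) ->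
  perm_prefix h g f.
Proof.
move=> ih jh gi gj gx; split; last by move=> x hx; apply: gx; lia.
pose s x := if x == i then j else if x == j then i else x.
have sK : involutive s.
  by move=> x; rewrite /s; do !case: eqP => //; congruence.
have ->: mkseq g h = map f (map s (iota 0 h)).
  rewrite -map_comp; apply: eq_map => x; rewrite /= /s.
  case: eqP => [->//|/eqP xi]; case: eqP => [->//|/eqP xj]; exact: gx.
apply/perm_map/uniq_perm; rewrite ?map_inj_uniq ?iota_uniq //; first exact: inv_inj.
move=> x; rewrite -[in LHS](sK x) mem_map; last exact: inv_inj.
by rewrite !mem_iota /s; case: eqP => [->|_]; [lia | case: eqP => [->|_]; lia].
Qed.

Definition parent (c : nat) : nat := c.-1./2.

Section Heapsort.
Context {disp : Order.disp_t} {key_type : orderType disp}.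
Variables (key : nat -> key_type) (below : nat -> nat -> program bool).
Variables (a : array) (M0 : memory) (T l : nat).
(** The keys are stored outside the array [a] that is being sorted, so comparisons need only be
    correct in memories that agree with [M0] off [a]. *)
Hypothesis below_spec : forall M x y, same_except [:: a] M0 M ->
  runs (below x y) M T (fun b M' => b = (key x < key y)%O /\ M' = M).

(* In the range [r0, h), the only place where the heap property may fail is
   between [r] and its children. *)
Definition heap_but (r0 h r : nat) (A : nat -> nat) : Prop :=
  (forall c, 0 < c < h -> r0 <= parent c -> parent c != r ->
     (key (A c) <= key (A (parent c)))%O) /\
  (forall c, 0 < c < h -> parent c = r -> 0 < r -> r0 <= parent r ->
     (key (A c) <= key (A (parent r)))%O).

Definition heap (r0 h : nat) (A : nat -> nat) : Prop :=
  forall c, 0 < c < h -> r0 <= parent c -> (key (A c) <= key (A (parent c)))%O.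

Lemma same_except_upd M j v : same_except [:: a] M0 M ->
  same_except [:: a] M0 (upd M a j v).
Proof.
move=> s b ba x; rewrite upd_neq ?s //; by move: ba; rewrite inE.
Qed.

(* As an index at least doubles when passing to a child, [h < (r + 1) * 2 ^ j]
   leaves at most [j] levels below [r]. *)
Lemma sift_down_spec r0 h fuel r j M :
  r0 <= r -> h <= fuel + r -> h < r.+1 * 2 ^ j ->
  same_except [:: a] M0 M -> heap_but r0 h r (M a) ->
  runs (sift_down below a h fuel r) M (j * (10 + 2 * T) + 2)
    (fun _ M' => [/\ same_except [:: a] M0 M', heap r0 h (M' a)
       & perm_prefix h (M' a) (M a)]).
Proof.
elim: fuel r j M => [|fuel IH] r j M r0r hf hj sM [hb1 hb2] /=.
  apply: runs_ret; split=> //.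
  move=> c ch r0c; apply: hb1 => //; apply/eqP => cr; rewrite /parent in cr r0c; lia.
(* A level costs at most ten unit instructions and two comparisons. The extra 2 in the bound pays
   for the final test that finds no child. *)
apply: runs_calc_bind; first lia.
apply: runs_calc_bind; first lia.
case: ifP => [ch|/negbT hc]; last first.
  apply: runs_ret; split=> //.
  move=> c c0h r0c; apply: hb1 => //; apply/eqP => cr; rewrite /parent in cr r0c; lia.
case: j hj => [|j] hj; first by rewrite expn0 in hj; lia.
rewrite expnS in hj.
apply: runs_read_bind; first lia.
apply: runs_calc_bind; first lia.
apply: (@runs_bind _ _ _ _ _ (T + 2) _ (fun d M' => M' = M /\
   [/\ d < h, 0 < d, parent d = r & forall c, 0 < c < h -> parent c = r ->
      (key (M a c) <= key (M a d))%O])); [|lia|].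
  case: ifP => [ch2|/negbT hc2].
    apply: runs_read_bind; first lia.
    apply: (runs_bind (below_spec _ _ sM)); first lia.
    move=> _ _ [-> ->]; apply: runs_calc; first lia.
    split=> //; rewrite /parent; case: ltP => cmp; split=> //; try lia.
      move=> c c0h cr; have [->|->] : c = (2 * r).+1 \/ c = (2 * r).+2 by lia.
        exact: ltW.
      exact: lexx.
    move=> c c0h cr; have [->//|->//] : c = (2 * r).+1 \/ c = (2 * r).+2 by lia.
  apply: runs_ret; split=> //; rewrite /parent; split=> //; try lia.
  by move=> c c0h cr; have -> : c = (2 * r).+1 by lia.
move=> d _ [-> [dh d0 dr dmax]].
apply: runs_read_bind; first lia.
apply: runs_read_bind; first lia.
apply: (runs_bind (below_spec _ _ sM)); first lia.
move=> _ _ [-> ->]; case: ltP => cmp; last first.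
  apply: runs_ret; split=> //.
  move=> c c0h r0c; have [cr|] := eqVneq (parent c) r; last exact: hb1.
  by rewrite cr (le_trans (dmax _ _ _)).
apply: runs_write_bind; first lia.
apply: runs_write_bind; first lia.
have rd : r < d by rewrite /parent in dr; lia.
set M2 := upd _ _ _ _.
have M2d : M2 a d = M a r by rewrite /M2 updE eqxx.
have M2r : M2 a r = M a d by rewrite /M2 updE ltn_eqF // updE eqxx.
have M2x x : x != r -> x != d -> M2 a x = M a x.
  by move=> /negbTE xr /negbTE xd; rewrite /M2 !updE xd xr.
have sM2 : same_except [:: a] M0 M2 by do 2!apply: same_except_upd.
have hlt : h < d.+1 * 2 ^ j.
  by apply: leq_trans hj _; rewrite mulnA leq_mul2r /parent in dr *; lia.
have hb : heap_but r0 h d (M2 a).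
  split=> c c0h; last first.
    move=> cd _ _; rewrite dr M2r M2x; try by rewrite /parent in cd; lia.
    by rewrite -cd; apply: hb1; rewrite ?cd; lia.
  move=> r0c cd; have [cr|cr] := eqVneq (parent c) r.
    rewrite cr M2r; have [->|cd'] := eqVneq c d; first by rewrite M2d ltW.
    by rewrite M2x ?dmax //; rewrite /parent in cr; lia.
  (* [r] now holds the former entry of its child [d]; the second clause of [heap_but] compares that
     entry with the parent of [r]. *)
  have [cr'|cr'] := eqVneq c r.
    rewrite cr' in c0h r0c cd cr *; rewrite M2r M2x //.
    by apply: hb2; lia.
  have cd' : c != d by apply: contraNneq cr => ->; rewrite dr.
  by rewrite !M2x //; apply: hb1.
have rf : h <= fuel + d by lia.
have le_r0d : r0 <= d by lia.
apply: (runs_weaken (IH _ _ _ le_r0d rf hlt sM2 hb)); first by lia.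
move=> _ M' [s1 h1 p1]; split=> //.
apply: perm_prefix_trans p1 _.
by apply: (@perm_prefix_swap _ _ _ r d) => //; lia.
Qed.

Lemma heap_root_max h A c : heap 0 h A -> c < h -> (key (A c) <= key (A 0))%O.
Proof.
move=> hp; elim/ltn_ind: c => -[//|c] IH ch.
apply: le_trans (hp c.+1 _ _) _; rewrite ?ch //.
by apply: IH; rewrite /parent /=; lia.
Qed.

(** With [TS] for the sifting cost, each of at most [h] parents is charged [TS + 3] and each of at
    most [h] rounds [TS + 7], loop tests included; this gives the factor 2 and the summand 10. The
    result is sorted by key, with no claim on the order of equal keys. *)
Lemma heap_sort_spec h M : same_except [:: a] M0 M -> h < 2 ^ l ->
  runs (heap_sort below a h) M (4 + h * (2 * (l * (10 + 2 * T)) + 10))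
    (fun _ M' => [/\ same_except [:: a] M0 M', perm_prefix h (M' a) (M a)
       & forall i j, i < j < h -> (key (M' a i) <= key (M' a j))%O]).
Proof.
move=> sM hl.
set TS := l * (10 + 2 * T).
apply: runs_calc_bind; first lia.
pose I r0 M' := [/\ same_except [:: a] M0 M', perm_prefix h (M' a) (M a)
  & heap r0 h (M' a)].
apply: (@runs_bind _ _ _ _ _ (1 + h./2 * (TS + 2).+1) _ (fun _ => I 0)).
- apply: (@runs_for_down _ _ I).
    split=> //.
    (* Cells from [h./2] on have no children inside the heap. *)
    by move=> c c0h; rewrite /parent; lia.
  move=> r M' rh [s' p' h'].
  have hb : heap_but r h r (M' a).
    (* The second clause is vacuous here: the parent of [r] precedes [r] and is outside the
       range. *)
    split=> c c0h; last by rewrite /parent; lia.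
    by move=> rc cr; apply: h' => //; lia.
  have hl' : h < r.+1 * 2 ^ l by apply: leq_trans hl _; rewrite leq_pmull.
  apply: (runs_weaken (sift_down_spec (leqnn r) _ hl' s' hb)) => //; first lia.
  move=> _ M2 [s2 h2 p2]; split=> //; exact: perm_prefix_trans p'.
- have: h./2 * (TS + 2).+1 <= h * (TS + 3) by rewrite leq_mul //; lia.
  by lia.
move=> _ M1 [s1 p1 h1]; apply: runs_calc_bind.
  have: h./2 * (TS + 2).+1 <= h * (TS + 3) by rewrite leq_mul //; lia.
  by lia.
(* [e] rounds remain: a heap on [0, e], and a sorted upper part of larger keys *)
pose J e M' := [/\ same_except [:: a] M0 M', perm_prefix h (M' a) (M a),
  heap 0 e.+1 (M' a) &
  forall i j, i < j < h -> e < j -> (key (M' a i) <= key (M' a j))%O].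
apply: (@runs_weaken _ _ _ (1 + h.-1 * (TS + 6).+1) _ (fun _ => J 0)).
- apply: (@runs_for_down _ _ J).
    split=> //; last by move=> i j; lia.
    by move=> c c0h; apply: h1; lia.
  move=> e M' eh [s' p' h' o'].
  apply: runs_read_bind; first lia.
  apply: runs_read_bind; first lia.
  apply: runs_write_bind; first lia.
  apply: runs_write_bind; first lia.
  set M3 := upd _ _ _ _.
  have s3 : same_except [:: a] M0 M3 by do 2!apply: same_except_upd.
  have M3e : M3 a e.+1 = M' a 0 by rewrite /M3 updE eqxx.
  have M30 : M3 a 0 = M' a e.+1 by rewrite /M3 updE updE.
  have M3x x : x != 0 -> x != e.+1 -> M3 a x = M' a x.
    by move=> /negbTE x0 /negbTE xe; rewrite /M3 !updE xe x0.
  have hb : heap_but 0 e.+1 0 (M3 a).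
    split=> // c c0h _ c0; rewrite !M3x; try (rewrite /parent; lia).
      by apply: h'; lia.
    exact: c0.
  have hl' : e.+1 < 1 * 2 ^ l by lia.
  have p3 : perm_prefix e.+2 (M3 a) (M' a).
    by apply: (@perm_prefix_swap _ _ _ 0 e.+1).
  apply: (runs_weaken (sift_down_spec (leqnn 0) _ hl' s3 hb)); [lia|rewrite -/TS; lia|].
  move=> _ M4 [s4 h4 p4]; split=> //.
    apply: perm_prefix_trans p'; apply: (@perm_prefix_trans _ (M3 a)).
      by apply: perm_prefix_widen p4; lia.
    by apply: perm_prefix_widen p3; lia.
  have p43 : perm_prefix e.+2 (M4 a) (M' a).
    by apply: perm_prefix_trans p3; apply: perm_prefix_widen p4; lia.
  move=> i j ijh ej.
  (* Cell [e.+1] received the old root, a maximum of the heap. Cells beyond it are unchanged, and a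
     smaller index holds either an unchanged entry or one from the old prefix. *)
  have [je|je] := eqVneq j e.+1.
    rewrite je (p4.2 e.+1) // M3e.
    have [|i' i'e ->] := perm_prefix_inv p43 (i := i); first lia.
    exact: heap_root_max h' _.
  rewrite (p43.2 j); last lia.
  have [ie|ie] := leqP e.+2 i; first by rewrite (p43.2 i) //; apply: o'; lia.
  by have [i' i'e ->] := perm_prefix_inv p43 ie; apply: o'; lia.
- have: h./2 * (TS + 2).+1 <= h * (TS + 3) by rewrite leq_mul //; lia.
  have: h.-1 * (TS + 6).+1 <= h * (TS + 7) by rewrite leq_mul //; lia.
  by lia.
by move=> _ M' [s' p' _ o']; split=> // i j ij; apply: o'; lia.
Qed.
End Heapsort.

(** * Kernelization *)

Definition row_of (n : nat) (M : memory) (s : nat) : seqlexi nat :=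
  mkseq (M (BINS s)) n.

Lemma mkseq_eqP (T : Type) (f g : nat -> T) n :
  mkseq f n = mkseq g n <-> forall i, i < n -> f i = g i.
Proof.
split=> [fg i lin|fg]; first by rewrite -(nth_mkseq (f 0) f lin) fg nth_mkseq.
apply: (@eq_from_nth _ (f 0)); rewrite ?size_mkseq // => i lin.
by rewrite !nth_mkseq ?fg.
Qed.

Lemma ltxi_mkseq (f g : nat -> nat) n x : x < n ->
  (forall i, i < x -> f i = g i) -> f x != g x ->
  ((mkseq f n : seqlexi nat) < mkseq g n)%O = (f x < g x).
Proof.
elim: x f g n => [|x IH] f g [//|n] xn fg fgx;
  rewrite /mkseq /= ltxi_cons (iotaDl 1 0 n) -!map_comp !leEnat.
  by case: ltngtP fgx.
rewrite fg // leqnn; apply: IH => // i ix; exact: fg.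
Qed.

Lemma first_difference_spec s s' j cnt M :
  runs (first_difference s s' j cnt) M (4 * cnt).+1 (fun x M' =>
    [/\ M' = M, j <= x <= j + cnt,
       forall i, j <= i < x -> M (BINS s) i = M (BINS s') i
     & x < j + cnt -> M (BINS s) x != M (BINS s') x]).
Proof.
elim: cnt j => [|cnt IH] j /=.
  by apply: runs_calc_bind => //; apply: runs_ret; split=> //; lia.
apply: runs_calc_bind => //.
apply: runs_read_bind; first lia.
apply: runs_read_bind; first lia.
apply: runs_calc_bind; first lia.
case: eqP => [e|/eqP ne].
  apply: (runs_weaken (IH _)); first lia.
  move=> x _ [-> jx ag df]; split=> //; last (by move=> xj; apply: df; lia); first lia.
  move=> i ijx; have [->//|ij] := eqVneq i j; apply: ag; lia.
by apply: runs_ret; split=> //; lia.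
Qed.

Lemma row_difference_spec n s s' M :
  runs (first_difference s s' 0 n) M (4 * n).+1 (fun x M' =>
    [/\ M' = M, (x < n) = (row_of n M s != row_of n M s')
     & x < n -> (row_of n M s < row_of n M s')%O
                = (M (BINS s) x < M (BINS s') x)]).
Proof.
apply: (runs_weaken (first_difference_spec s s' 0 n M)) => // x _ [-> xn ag df].
have [lt_xn|le_nx] := ltnP x n; last first.
  split=> //; symmetry; apply/negbF/eqP/mkseq_eqP => i lin; apply: ag; lia.
split=> //; last by move=> _; apply: ltxi_mkseq (df _) => // i ix; apply: ag; lia.
symmetry; apply/negP => /eqP/mkseq_eqP/(_ x lt_xn) e.
by move: (df lt_xn); rewrite e eqxx.
Qed.

Lemma below_first_spec n s s' M :
  runs (below_first n s s') M (4 * n + 5) (fun b M' =>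
    b = (row_of n M s < row_of n M s')%O /\ M' = M).
Proof.
apply: (runs_bind (row_difference_spec n s s' M)); first lia.
move=> x _ [-> xE lt_row]; apply: runs_calc_bind; first lia.
case: ifP => [xn|/negbT xn].
  apply: runs_read_bind; first lia.
  apply: runs_read_bind; first lia.
  by apply: runs_calc; [lia | split=> //; rewrite lt_row].
apply: runs_ret; split=> //; move: xn; rewrite xE negbK => /eqP ->.
by rewrite ltxx.
Qed.

(** Heapsort is not stable. With the previous position as second component, distinct kept curves
    have distinct keys, and curves in a common bin keep their relative order. *)
Definition next_key (i : nat) (M : memory) (s : nat) : nat *l nat :=
  (M (BINS s) i, M (KPOS i.-1) s).

Lemma below_next_spec i s s' M :
  runs (below_next i s s') M 6 (fun b M' =>
    b = (next_key i M s < next_key i M s')%O /\ M' = M).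
Proof.
do 2!apply: runs_read_bind => //.
apply: runs_calc_bind => //; rewrite ltxi_pair !leEnat !ltEnat /=.
case: eqP => [->|/eqP ne].
  by do 2!apply: runs_read_bind => //; apply: runs_calc; rewrite // leqnn.
by apply: runs_calc => //; split=> //; case: ltngtP ne.
Qed.

Definition removed_with (M : memory) (r : nat) : seq nat :=
  [seq M SORTED j | j <- iota (M FIRST r).+1 (M LAST r - (M FIRST r).+1)].

(** Listed as emitted from bottom to top: the representative comes last because the removed curves
    go directly below it. *)
Definition block (M : memory) (r : nat) : seq nat :=
  rcons (removed_with M r) r.

Record kernel (n m q : nat) (M0 M : memory) : Prop := Kernel {
  kernel_blocks : perm_eq (flatten (map (block M) (mkseq (M KEPT) q))) (iota 0 m);
  kernel_same_row : forall r s, r \in mkseq (M KEPT) q -> s \in block M r ->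
    row_of n M0 s = row_of n M0 r;
  kernel_distinct_rows : uniq (map (row_of n M0) (mkseq (M KEPT) q))
}.

Lemma same_exceptS bs cs M M' : {subset bs <= cs} ->
  same_except bs M M' -> same_except cs M M'.
Proof. by move=> sub s b bc; apply: s; apply: contra bc; apply: sub. Qed.

Lemma same_except_trans bs M1 M2 M3 :
  same_except bs M1 M2 -> same_except bs M2 M3 -> same_except bs M1 M3.
Proof. by move=> s1 s2 b bb x; rewrite s2 ?s1. Qed.

Lemma same_except_write bs M a j v : a \in bs -> same_except bs M (upd M a j v).
Proof.
by move=> abs b bb x; rewrite upd_neq //; apply: contraNneq bb => ->.
Qed.

Lemma row_of_same n bs M M' s : BINS s \notin bs -> same_except bs M M' ->
  row_of n M' s = row_of n M s.
Proof. by move=> b sM; apply/mkseq_eqP => i _; rewrite sM. Qed.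

Section KernelLoop.
Context {disp : Order.disp_t} {key_type : orderType disp}.
Variables (key : nat -> key_type) (srt : nat -> nat) (m : nat).
Hypothesis srt_sorted :
  forall i j, i < j < m -> (key (srt i) <= key (srt j))%O.

(** In contrast to [block], the representative comes first, as in the sorted array; the slices of
    the kept curves therefore concatenate literally to the processed prefix. *)
Definition slice (M : memory) (r : nat) : seq nat :=
  [seq srt j | j <- iota (M FIRST r) (M LAST r - M FIRST r)].

(** [inv_last] includes that [r] has the largest key so far. As the array is sorted, a key that
    differs from that of [r] exceeds all kept keys, so comparing with the last representative alone
    detects a new row. *)
Record kernel_inv (p q r : nat) (M : memory) : Prop := KernelInv {
  inv_flatten : flatten (map (slice M) (mkseq (M KEPT) q)) = mkseq srt p;
  inv_slice : forall x, x \in mkseq (M KEPT) q ->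
    [/\ M FIRST x < M LAST x, srt (M FIRST x) = x
      & forall j, M FIRST x <= j < M LAST x -> key (srt j) = key x];
  inv_uniq : uniq (map key (mkseq (M KEPT) q));
  inv_last : 0 < p ->
    [/\ 0 < q, M KEPT q.-1 = r, M LAST r = p
      & forall t, t < p -> (key (srt t) <= key r)%O];
  inv_empty : p = 0 -> q = 0
}.

Lemma inv_kept p q r M x : kernel_inv p q r M -> x \in mkseq (M KEPT) q ->
  exists2 t, t < p & x = srt t.
Proof.
case=> fl sl _ _ _ xK; have [lt_x fx _] := sl x xK.
have: x \in mkseq srt p.
  rewrite -fl; apply/flatten_mapP; exists x => //.
  by rewrite -[x in x \in _]fx map_f // mem_iota; lia.
by move/mapP=> [t]; rewrite mem_iota => tp ->; exists t; first lia.
Qed.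

Lemma kernel_inv_new p q r M M' (s := srt p) : p < m ->
  kernel_inv p q r M -> (p == 0) || (key r != key s) ->
  (forall j, j < q -> M' KEPT j = M KEPT j) -> M' KEPT q = s ->
  (forall x, x != s -> M' FIRST x = M FIRST x) -> M' FIRST s = p ->
  (forall x, x != s -> M' LAST x = M LAST x) -> M' LAST s = p.+1 ->
  kernel_inv p.+1 q.+1 s M'.
Proof.
move=> pm inv new Kj Kq Fx Fs Lx Ls; case: (inv) => fl sl un la em.
have KE : mkseq (M' KEPT) q.+1 = rcons (mkseq (M KEPT) q) s.
  by rewrite mkseqS Kq; congr rcons; apply/mkseq_eqP.
have keyK x : x \in mkseq (M KEPT) q -> key x != key s.
  move=> xK; case: (posnP p) => [p0|p0].
    by move: xK; rewrite (em p0).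
  have [q0 Kr Lr ub] := la p0; rewrite (gtn_eqF p0) /= in new.
  have rK : r \in mkseq (M KEPT) q by rewrite -Kr map_f // mem_iota /=; lia.
  have [t' t'p rE] := inv_kept inv rK; have [t tp xE] := inv_kept inv xK.
  have lt_rs : (key r < key s)%O by rewrite lt_neqAle new rE srt_sorted // t'p.
  by rewrite lt_eqF // (le_lt_trans _ lt_rs) // xE ub.
have neK x : x \in mkseq (M KEPT) q -> x != s.
  by move=> /keyK; apply: contraNneq => ->.
split.
- rewrite KE map_rcons flatten_rcons mkseqS -cats1; congr cat.
    rewrite -fl; congr flatten; apply/eq_in_map => x /neK xs.
    by rewrite /slice Fx ?Lx.
  by rewrite /slice Fs Ls subSnn.
- move=> x; rewrite KE mem_rcons inE; case: eqP => [-> _|_ /= xK].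
    by rewrite Fs Ls; split=> // j jp; have ->: j = p by lia.
  by rewrite Fx ?Lx ?neK //; apply: sl.
- rewrite KE map_rcons rcons_uniq un andbT.
  by apply/mapP => -[x /keyK + e]; rewrite e eqxx.
- move=> _; split=> // t tp; have [->//|tp'] := eqVneq t p.
  by apply: srt_sorted; lia.
- by [].
Qed.

Lemma kernel_inv_extend p q r M M' : 0 < p ->
  kernel_inv p q r M -> key r = key (srt p) ->
  (forall j, M' KEPT j = M KEPT j) -> (forall x, M' FIRST x = M FIRST x) ->
  (forall x, x != r -> M' LAST x = M LAST x) -> M' LAST r = p.+1 ->
  kernel_inv p.+1 q r M'.
Proof.
move=> p0 inv keyr Kj Fx Lx Lr; case: (inv) => fl sl un la em.
have [/= q0 Kr Lr0 ub] := la p0.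
have KE : mkseq (M' KEPT) q = mkseq (M KEPT) q by apply/mkseq_eqP.
have KE' : mkseq (M KEPT) q = rcons (mkseq (M KEPT) q.-1) r.
  by rewrite -[in LHS](prednK q0) mkseqS Kr.
have rK : r \in mkseq (M KEPT) q by rewrite KE' mem_rcons mem_head.
have [Flt Fr kr] := sl r rK; rewrite /= Lr0 in Flt kr.
have un' : r \notin mkseq (M KEPT) q.-1.
  by move: (map_uniq un); rewrite KE' rcons_uniq => /andP[].
split=> //.
- rewrite KE mkseqS -fl /= KE' !map_rcons !flatten_rcons -cats1 -catA.
  congr (flatten _ ++ _).
    apply/eq_in_map => x xK; rewrite /slice Fx Lx //.
    by apply: contraNneq un' => <-.
  rewrite /slice Fx Lr Lr0 subSn; last exact: ltnW.
  by rewrite -addn1 iotaD map_cat /= subnKC //; apply: ltnW.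
- rewrite KE => x xK; have [->|xr] := eqVneq x r; last by rewrite Fx Lx //; apply: sl.
  rewrite Fx Lr; split=> //; first exact: ltnW.
  by move=> j jF; have [->|jp] := eqVneq j p; [rewrite keyr | apply: kr; lia].
- by rewrite KE.
- move=> _; split=> //; first by rewrite Kj.
  by move=> t tp; have [->|tp'] := eqVneq t p; [rewrite keyr lexx | apply: ub; lia].
Qed.
End KernelLoop.

Lemma sort_rows_spec n m l M : m < 2 ^ l ->
  runs (for_up 0 m tt (fun s _ => write SORTED s s) ;;
        heap_sort (below_first n) SORTED m) M
    (m.*2 + 5 + m * (2 * (l * (10 + 2 * (4 * n + 5))) + 10)) (fun _ M' =>
    [/\ same_except [:: SORTED] M M',
        perm_eq (mkseq (M' SORTED) m) (iota 0 m)
      & forall i j, i < j < m ->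
          (row_of n M (M' SORTED i) <= row_of n M (M' SORTED j))%O]).
Proof.
move=> ml.
pose I p (_ : unit) M' := same_except [:: SORTED] M M' /\
  forall j, j < p -> M' SORTED j = j.
apply: (@runs_bind _ _ _ _ _ (1 + m * 2) _ (fun x => I (0 + m) x)).
- apply: (@runs_for_up_const _ _ _ I) => // i x M' im [sM id].
  apply: runs_write => //; split.
    by apply: same_except_trans sM _; apply: same_except_write; rewrite inE.
  move=> j ji; rewrite updE; case: eqP => [->//|/eqP ne]; apply: id; lia.
- lia.
move=> _ M1 [s1 id1].
have bs M' x y : same_except [:: SORTED] M M' ->
    runs (below_first n x y) M' (4 * n + 5) (fun b M'' =>
      b = (row_of n M x < row_of n M y)%O /\ M'' = M').
  move=> sM; rewrite -(@row_of_same n _ _ _ x _ sM) // -(@row_of_same n _ _ _ y _ sM) //.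
  exact: below_first_spec.
apply: (runs_weaken (heap_sort_spec bs s1 ml)); first lia.
move=> _ M2 [s2 [p2 _] o2]; split=> //; apply: perm_trans p2 _.
suff ->: mkseq (M1 SORTED) m = iota 0 m by [].
by rewrite -[RHS]map_id; apply/mkseq_eqP => i im; apply: id1.
Qed.

(** Sequences nest to the right; regrouping lets one specification cover the first two commands as a
    unit. *)
Lemma runs_bindA A1 A2 A3 (c : program A1) (f : A1 -> program A2)
    (g : A2 -> program A3) M T Q :
  runs (bind (bind c f) g) M T Q -> runs (bind c (fun x => bind (f x) g)) M T Q.
Proof.
rewrite /runs /bind; case: (c M) => x M1 t1; case: (f x M1) => y M2 t2.
by case: (g y M2) => z M3 t3 /=; rewrite addnA.
Qed.

(** A block is its slice with the first entry moved to the end. *)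
Lemma blocks_slices srt K M : (forall j, M SORTED j = srt j) ->
  (forall x, x \in K -> M FIRST x < M LAST x /\ srt (M FIRST x) = x) ->
  perm_eq (flatten (map (block M) K)) (flatten (map (slice srt M) K)).
Proof.
move=> srtE; elim: K => //= x K IH sl.
apply: perm_cat; last by apply: IH => y yK; apply: sl; rewrite inE yK orbT.
have [lt_x fx] := sl x (mem_head _ _).
rewrite /block /removed_with /slice (eq_map srtE).
by rewrite -[M LAST x - M FIRST x]prednK ?subn_gt0 //= fx -subnS perm_rcons.
Qed.

Lemma kernelize_spec n m l M : m < 2 ^ l ->
  runs (kernelize n m) M
    (m.*2 + 5 + m * (2 * (l * (10 + 2 * (4 * n + 5))) + 10)
     + (1 + m * (4 * n + 10)))
    (fun q M' => same_except [:: SORTED; KEPT; FIRST; LAST] M M' /\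
                 kernel n m q M M').
Proof.
move=> ml; rewrite /kernelize; apply: runs_bindA.
apply: (runs_bind (sort_rows_spec n M ml)); first lia.
move=> _ M1 [s1 p1 o1].
pose I p (qr : nat * nat) M' := same_except [:: KEPT; FIRST; LAST] M1 M' /\
  kernel_inv (row_of n M) (M1 SORTED) p qr.1 qr.2 M'.
apply: (@runs_bind _ _ _ _ _ (1 + m * (4 * n + 9).+1) _ (I (0 + m))).
- apply: (@runs_for_up_const _ _ _ I).
    by split=> //; split.
  move=> p [q r] M2 pm [s2 /= inv].
  have rowE x : row_of n M2 x = row_of n M x.
    by rewrite (@row_of_same n _ _ _ x _ s2) ?(@row_of_same n _ _ _ x _ s1).
  apply: runs_read_bind; first lia.
  apply: runs_calc_bind; first lia.
  set s := M2 SORTED p; have sE : s = M1 SORTED p by rewrite /s s2.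
  apply: (@runs_bind _ _ _ _ _ (4 * n + 2) _ (fun b M' => M' = M2 /\
    b = (p == 0) || (row_of n M r != row_of n M s))); [|lia|].
    case: eqP => _; first exact: runs_ret.
    apply: (runs_bind (row_difference_spec n r s M2)); first lia.
    move=> x _ [-> xE _]; apply: runs_calc; first lia.
    by split=> //; rewrite xE !rowE.
  move=> b _ [-> bE]; case: ifP => b01.
    do 3![apply: runs_write_bind; first lia]; apply: runs_calc; first lia.
    split=> /=.
      apply: same_except_trans s2 _.
      apply: (@same_except_trans _ _ (upd M2 KEPT q s)).
        exact: same_except_write.
      apply: (@same_except_trans _ _ (upd (upd M2 KEPT q s) FIRST s p));
        exact: same_except_write.
    rewrite {1}sE; apply: (kernel_inv_new (r := r) (M := M2) o1); rewrite -?sE //.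
    + by rewrite -bE b01.
    + by move=> j jq; rewrite /upd /= ltn_eqF.
    + by rewrite /upd /= eqxx.
    + by move=> x /negbTE xs; rewrite /upd /= xs.
    + by rewrite /upd /= eqxx.
    + by move=> x /negbTE xs; rewrite updE xs.
    + by rewrite updE eqxx.
  apply: runs_write_bind; first lia.
  apply: runs_ret; split=> /=.
    by apply: same_except_trans s2 _; apply: same_except_write.
  move: b01; rewrite bE => /norP[p0 /negPn/eqP rs].
  apply: (kernel_inv_extend (M := M2)) => //; rewrite ?lt0n -?sE //.
    by move=> x /negbTE xs; rewrite updE xs.
  by rewrite updE eqxx.
- lia.
move=> [q r] M2 [s2 [fl sl un _ _]]; apply: runs_ret => /=.
have srtE j : M2 SORTED j = M1 SORTED j by rewrite s2.
split.
  apply: (@same_except_trans _ _ M1); apply: same_exceptS s1 || apply: same_exceptS s2.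
    by move=> x; rewrite !inE => ->.
  by move=> x; rewrite !inE orbA => /orP[] ->; rewrite !orbT.
rewrite add0n in fl; split=> //=.
  apply: perm_trans p1; rewrite -fl; apply: blocks_slices => // x.
  by move=> /sl[].
move=> x s xK; rewrite mem_rcons inE => /orP[/eqP-> //|].
have [lt_x fx kx] := sl x xK.
move=> /mapP[j]; rewrite mem_iota => jx ->; rewrite srtE; apply: kx; lia.
Qed.

(** * Minimality *)

(** For a fixed pair of curves, [x] and [y] tell which one is lower under the algorithm and under
    the competitor, and [d] marks the elements where their bins differ. *)
Lemma greedy_switches (x y d : nat -> bool) n :
  (forall i, i < n -> ~~ d i.+1 -> x i.+1 = x i) ->
  (forall i, i <= n -> d i -> x i = y i) ->
  (forall j, j <= n -> d j -> (forall i, i < j -> ~~ d i) -> x 0 = x j) ->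
  \sum_(i < n) (x i != x i.+1) <= \sum_(i < n) (y i != y i.+1).
Proof.
move=> keep forced first.
pose sx k := \sum_(i < k) (x i != x i.+1).
pose sy k := \sum_(i < k) (y i != y i.+1).
suff: ((forall i, i <= n -> ~~ d i) /\ sx n = 0) \/ sx n + (x n != y n) <= sy n.
  by rewrite -/(sx n) -/(sy n) => -[[_ ->]|] //; apply/leq_trans/leq_addr.
(* In the left case [x] still has its initial value, which by [first] is already the one forced at
   the first marked element. Entering the right case is therefore free for the algorithm, even if
   the competitor disagreed before. *)
suff: forall k, k <= n ->
    ((forall i, i <= k -> ~~ d i) /\ x k = x 0 /\ sx k = 0) \/
    sx k + (x k != y k) <= sy k.
  by move=> /(_ n (leqnn n)) [[nd [_ s0]]|]; [left | right].
have [sx0 sy0] : sx 0 = 0 /\ sy 0 = 0 by rewrite /sx /sy !big_ord0.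
have sxS k : sx k.+1 = sx k + (x k != x k.+1) by rewrite /sx big_ord_recr.
have syS k : sy k.+1 = sy k + (y k != y k.+1) by rewrite /sy big_ord_recr.
clearbody sx sy; elim=> [_|k IH kn].
  case: (boolP (d 0)) => d0; [right | left].
    by rewrite sx0 sy0 forced // eqxx.
  by rewrite sx0; split=> // -[|i].
have [dk|ndk] := boolP (d k.+1).
  right; rewrite sxS syS -(forced _ kn dk) eqxx addn0.
  case: (IH (ltnW kn)) => [[nd [xk ->]]|].
    by rewrite xk (first _ kn dk) ?eqxx // => i ik; apply: nd.
  (* Both sides agree at [k.+1]. If they agreed at [k], they switch together; if they disagreed, the
     unit already reserved pays for a switch of [x]. *)
  by case: (x k) (y k) (x k.+1) => [] [] [] /=; lia.
have xkE := keep _ kn ndk; case: (IH (ltnW kn)) => [[nd [xk s0]]|IHk].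
  left; rewrite sxS s0 xkE eqxx; split=> // i.
  by rewrite leq_eqVlt => /orP[/eqP->|/nd].
by right; move: IHk; rewrite sxS syS xkE eqxx;
  case: (x k) (y k) (y k.+1) => [] [] [] /=; lia.
Qed.

Lemma sum_consecutive n (F : 'I_n.+1 -> 'I_n.+1 -> nat) :
  \sum_(i < n.+1) \sum_(j < n.+1 | j == i.+1 :> nat) F i j =
  \sum_(i < n) F (inord i) (inord i.+1).
Proof.
rewrite big_ord_recr /= [X in _ + X]big_pred0 ?addn0; last first.
  by move=> j; apply: ltn_eqF.
apply: eq_bigr => i _; rewrite (big_pred1 (inord i.+1)).
  by congr F; apply: val_inj; rewrite /= inordK // ltnS ltnW.
by move=> j; rewrite /= -[in RHS]val_eqE /= inordK // ltnS.
Qed.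

Lemma crossE m n (L : curve_order m n) i j s s' : s != s' ->
  cross L i j s s' = ((L i s < L i s') != (L j s < L j s')).
Proof.
move=> ss'; have ne k : (L k s' < L k s) = ~~ (L k s < L k s').
  have: L k s != L k s' :> nat by rewrite val_eqE (inj_eq perm_inj).
  by case: ltngtP.
by rewrite /cross !ne; do 2!case: (_ < _).
Qed.

(** A competitor cannot choose its pairs independently, but this is harmless: [L] meets the lower
    bound of every pair simultaneously. Hence the sums are exchanged so that pairs are outermost. *)
Lemma greedy_min_crossings m n k (B : 'M['I_k]_(m, n)) (L : curve_order m n) :
  respects_bins B L ->
  (forall (i j : 'I_n) s s', j = i.+1 :> nat -> B s j = B s' j ->
     (L j s < L j s') = (L i s < L i s')) ->
  (forall (i j : 'I_n) s s', i = 0 :> nat ->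
     (forall x : 'I_n, x < j -> B s x = B s' x) -> B s j < B s' j ->
     L i s < L i s') ->
  min_crossings B L.
Proof.
case: n => [|n] in B L *; move=> resp keep first; split=> // L' resp'.
  by rewrite /crossings !big_ord0.
have crossingsE (L1 : curve_order m n.+1) : crossings L1 =
    \sum_(s < m) \sum_(s' < m | s < s') \sum_(i < n)
      ((L1 (inord i) s < L1 (inord i) s')
       != (L1 (inord i.+1) s < L1 (inord i.+1) s')).
  rewrite /crossings sum_consecutive exchange_big; apply: eq_bigr => s _.
  rewrite exchange_big; apply: eq_bigr => s' ss'; apply: eq_bigr => i _.
  by rewrite crossE // -val_eqE ltn_eqF.
rewrite !crossingsE; apply: leq_sum => s _; apply: leq_sum => s' ss'.
have respE L1 (i : 'I_n.+1) : respects_bins B L1 -> B s i != B s' i ->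
    (L1 i s < L1 i s') = (B s i < B s' i).
  move=> r; rewrite -val_eqE; case: (ltngtP (B s i)) => // lt_b _;
    first by rewrite (r _ _ _ lt_b).
  by apply/negbTE; rewrite -leqNgt ltnW // (r _ _ _ lt_b).
apply: (@greedy_switches (fun i => L (inord i) s < L (inord i) s')
  (fun i => L' (inord i) s < L' (inord i) s')
  (fun i => B s (inord i) != B s' (inord i))) => [i lin|i lin|j jn].
- move=> /negPn/eqP; apply: keep.
  by rewrite !inordK // ltnS ltnW.
- by move=> d; rewrite !respE.
- move=> d nd; rewrite (respE _ _ resp d).
  have agree (x : 'I_n.+1) : x < (inord j : 'I_n.+1) -> B s x = B s' x.
    by rewrite inordK // => /nd/negPn/eqP; rewrite inord_val.
  move: d; rewrite -val_eqE; case: (ltngtP (B s (inord j))) => // lt_b _.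
    by apply: (first _ _ _ _ _ agree lt_b); rewrite inordK.
  apply/negbTE; rewrite -leqNgt ltnW //.
  apply: (first _ _ _ _ _ _ lt_b); first by rewrite inordK.
  by move=> x /agree ->.
Qed.

(** * Orders of the kept curves *)

Lemma copy_spec a a' h M : a != a' ->
  runs (copy a a' h) M (1 + h * 3) (fun _ M' =>
    same_except [:: a'] M M' /\ mkseq (M' a') h = mkseq (M a) h).
Proof.
move=> aa'; pose I p (_ : unit) M' :=
  same_except [:: a'] M M' /\ forall j, j < p -> M' a' j = M a j.
apply: (@runs_weaken _ _ _ (1 + h * 3) _ (fun x => I (0 + h) x)) => //.
  apply: (@runs_for_up_const _ _ _ I) => // p x M' ph [sM cp].
  apply: runs_read_bind => //; apply: runs_write => //; split.
    by apply: same_except_trans sM _; apply: same_except_write; rewrite inE.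
  move=> j jp; rewrite updE; case: eqP => [->|jp']; last by apply: cp; lia.
  by rewrite sM // inE.
by move=> _ M' [sM cp]; split=> //; apply/mkseq_eqP.
Qed.

Lemma record_positions_spec i h M : uniq (mkseq (M (KORDER i)) h) ->
  runs (record_positions i h) M (1 + h * 3) (fun _ M' =>
    same_except [:: KPOS i] M M' /\
    forall p, p < h -> M' (KPOS i) (M (KORDER i) p) = p).
Proof.
move=> /mkseq_uniqP inj; pose I p (_ : unit) M' :=
  same_except [:: KPOS i] M M' /\
  forall j, j < p -> M' (KPOS i) (M (KORDER i) j) = j.
apply: (@runs_weaken _ _ _ (1 + h * 3) _ (fun x => I (0 + h) x)) => //.
apply: (@runs_for_up_const _ _ _ I) => // p x M' ph [sM pos].
apply: runs_read_bind => //; apply: runs_write => //; split.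
  by apply: same_except_trans sM _; apply: same_except_write; rewrite inE.
move=> j jp; rewrite updE sM //; case: eqP => [/inj|ne].
  by rewrite !inE => -> //; lia.
by apply: pos; have: j != p by [apply: contra_notN ne => /eqP->]; lia.
Qed.

(** Merges the two kinds of keys, so that [ordered] and [order_spec] treat the first and the later
    elements alike. *)
Definition order_key_lt (n j : nat) (M : memory) (r r' : nat) : bool :=
  if j == 0 then (row_of n M r < row_of n M r')%O
  else (next_key j M r < next_key j M r')%O.

Record ordered (n q j : nat) (K : seq nat) (M : memory) : Prop := Ordered {
  ordered_perm : perm_eq (mkseq (M (KORDER j)) q) K;
  ordered_pos : forall p, p < q -> M (KPOS j) (M (KORDER j) p) = p;
  ordered_key : forall r r', r \in K -> r' \in K -> order_key_lt n j M r r' ->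
    M (KPOS j) r < M (KPOS j) r'
}.

(** Comparisons happen only while [KORDER i] changes, but [ordered] speaks of the keys after
    [KPOS i] has been written as well; hence two frame hypotheses of different width. *)
Lemma order_spec (disp : Order.disp_t)
    (key_type : orderType disp) (key : nat -> key_type) below T l n q i a K M :
  (forall M' x y, same_except [:: KORDER i] M M' ->
     runs (below x y) M' T (fun b M'' => b = (key x < key y)%O /\ M'' = M')) ->
  (forall M' x y, same_except [:: KORDER i; KPOS i] M M' ->
     order_key_lt n i M' x y = (key x < key y)%O) ->
  a != KORDER i -> mkseq (M a) q = K -> uniq K -> q < 2 ^ l ->
  runs (copy a (KORDER i) q ;; heap_sort below (KORDER i) q ;;
        record_positions i q) M
    (6 + q * 6 + q * (2 * (l * (10 + 2 * T)) + 10)) (fun _ M' =>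
    same_except [:: KORDER i; KPOS i] M M' /\ ordered n q i K M').
Proof.
move=> below_spec keyE aK MK uK ql.
apply: (runs_bind (copy_spec q M aK)); first lia.
move=> _ M1 [s1 c1]; apply: (runs_bind (heap_sort_spec below_spec s1 ql)); first lia.
move=> _ M2 [s2 [p2 _] o2].
have pK : perm_eq (mkseq (M2 (KORDER i)) q) K by rewrite -MK -c1.
have uM2 : uniq (mkseq (M2 (KORDER i)) q) by rewrite (perm_uniq pK).
apply: (runs_weaken (record_positions_spec uM2)); first lia.
move=> _ M3 [s3 pos3].
have K3 : M3 (KORDER i) =1 M2 (KORDER i) by apply: s3.
have s03 : same_except [:: KORDER i; KPOS i] M M3.
  apply: (@same_except_trans _ _ M2); apply: same_exceptS s2 || apply: same_exceptS s3.
    by move=> x; rewrite !inE => ->.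
  by move=> x; rewrite !inE => ->; rewrite orbT.
split=> //; split.
- by rewrite (eq_mkseq K3).
- by move=> p pq; rewrite K3 pos3.
- move=> r r'; rewrite -!(perm_mem pK) keyE // => /mapP[p + ->] /mapP[p' + ->].
  (* Sortedness is a weak inequality, so it is used by contraposition: [p' <= p] would bound the key
     at [p'] by the key at [p]. *)
  rewrite !mem_iota /= !add0n => pq pq'; rewrite !pos3 // ltNge (ltnNge p).
  apply: contra => p'p; have [->//|ne] := eqVneq p' p.
  by apply: o2; rewrite pq andbT ltn_neqAle ne.
Qed.

Lemma order_first_spec n l q M : uniq (mkseq (M KEPT) q) -> q < 2 ^ l ->
  runs (order_first n q) M
    (6 + q * 6 + q * (2 * (l * (10 + 2 * (4 * n + 5))) + 10)) (fun _ M' =>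
    same_except [:: KORDER 0; KPOS 0] M M' /\
    ordered n q 0 (mkseq (M KEPT) q) M').
Proof.
move=> uK ql; apply: (order_spec (key := row_of n M)) => // M' x y sM.
  rewrite -(@row_of_same n _ _ _ x _ sM) // -(@row_of_same n _ _ _ y _ sM) //.
  exact: below_first_spec.
by rewrite /order_key_lt !(@row_of_same n _ _ _ _ _ sM).
Qed.

Lemma order_next_spec n l q i M : i != 0 ->
  uniq (mkseq (M (KORDER i.-1)) q) -> q < 2 ^ l ->
  runs (order_next i q) M
    (6 + q * 6 + q * (2 * (l * (10 + 2 * 6)) + 10)) (fun _ M' =>
    same_except [:: KORDER i; KPOS i] M M' /\
    ordered n q i (mkseq (M (KORDER i.-1)) q) M').
Proof.
move=> i0 uK ql.
(* For [i = 0] the truncated predecessor would be [i] itself, and recording positions would alter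
   the keys. *)
have ii' : (i.-1 == i) = false by apply/eqP; lia.
have keyE bs M' x : BINS x \notin bs -> KPOS i.-1 \notin bs ->
    same_except bs M M' -> next_key i M' x = next_key i M x.
  by move=> bx px sM; rewrite /next_key !sM.
have pos_notin : KPOS i.-1 \notin [:: KORDER i; KPOS i].
  by rewrite !inE orFb; apply/eqP => -[]; lia.
apply: (order_spec (key := next_key i M)) => // [M' x y sM|M' x y sM|].
- rewrite -(keyE _ _ x _ _ sM) // -(keyE _ _ y _ _ sM) //.
  exact: below_next_spec.
- by rewrite /order_key_lt (negbTE i0) !(keyE _ _ _ _ _ sM).
- by apply/eqP => -[]; lia.
Qed.

(** The set of changed [KORDER] and [KPOS] arrays grows with the elements, so the arrays that
    survive are listed instead. *)
Record same_kernel (M M' : memory) : Prop := SameKernel {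
  same_bins : forall s, M' (BINS s) =1 M (BINS s);
  same_sorted : M' SORTED =1 M SORTED;
  same_kept : M' KEPT =1 M KEPT;
  same_first : M' FIRST =1 M FIRST;
  same_last : M' LAST =1 M LAST
}.

Lemma ordered_same n q j K M M' : same_kernel M M' ->
  M' (KORDER j) =1 M (KORDER j) -> M' (KPOS j) =1 M (KPOS j) ->
  (0 < j -> M' (KPOS j.-1) =1 M (KPOS j.-1)) ->
  ordered n q j K M -> ordered n q j K M'.
Proof.
move=> [bins _ _ _ _] ko kp kp' [perm pos key]; split.
- by rewrite (eq_mkseq ko).
- by move=> p pq; rewrite kp ko pos.
- move=> r r' rK r'K lt_key; rewrite !kp; apply: key => //.
  move: lt_key; rewrite /order_key_lt /next_key !bins; case: (eqVneq j 0) => [_|].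
    by rewrite /row_of !(eq_mkseq (bins _)).
  by rewrite -lt0n => j0; rewrite !(kp' j0).
Qed.

(** The factor [n.+1] covers [n = 0], where [order_first] still runs. The last summand holds the
    expensive comparisons of the first element. *)
Lemma order_all_spec n l q M (K := mkseq (M KEPT) q) : uniq K -> q < 2 ^ l ->
  runs (order_first n q ;; for_up 1 n.-1 tt (fun i _ => order_next i q)) M
    (n.+1 * (8 + q * 6 + q * (2 * (l * (10 + 2 * 6)) + 10))
     + q * (2 * (l * (10 + 2 * (4 * n + 5))) + 10))
    (fun _ M' => same_kernel M M' /\ forall j, j < n -> ordered n q j K M').
Proof.
move=> uK ql.
apply: (runs_bind (order_first_spec n uK ql)); first by rewrite mulSn; lia.
move=> _ M1 [s1 ord1].
pose I i (_ : unit) M' :=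
  same_kernel M M' /\ forall j, j < i -> ordered n q j K M'.
set T := 6 + q * 6 + q * (2 * (l * (10 + 2 * 6)) + 10).
apply: (@runs_weaken _ _ _ (1 + n.-1 * T.+1) _ (fun x => I (1 + n.-1) x)).
- apply: (@runs_for_up_const _ _ _ I).
    by split=> [|[|j] //]; split=> *; apply: s1; rewrite ?inE.
  move=> i x M2 i_n [k2 o2].
  have p2 : perm_eq (mkseq (M2 (KORDER i.-1)) q) K.
    by apply: (ordered_perm (o2 i.-1 _)); lia.
  apply: (runs_weaken (order_next_spec n _ _ ql));
    [lia | by rewrite (perm_uniq p2) | by [] |].
  move=> u M3 [s3 o3].
  have k3 : same_kernel M2 M3 by split=> *; apply: s3; rewrite ?inE.
  split.
    by case: k2 k3 => ? ? ? ? ? [? ? ? ? ?]; split=> *; congruence.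
  move=> j ji; have [->|ne] := eqVneq j i.
    (* The curves were copied from element [i.-1]; [p2] identifies them with the kept curves. *)
    by case: o3 => p3 pos3 key3; split=> [||r r' rK r'K]; [exact: perm_trans p2 | |
      apply: key3; rewrite (perm_mem p2)].
  have notin h : h != i -> (KORDER h \notin [:: KORDER i; KPOS i]) *
      (KPOS h \notin [:: KORDER i; KPOS i]).
    by move=> /eqP hi; rewrite !inE ?orbF ?orFb; split; apply/eqP => -[].
  have j'i : j.-1 != i by apply/eqP; lia.
  apply: (ordered_same k3) (o2 j _); try lia; move=> *; apply: s3;
    by rewrite ?(notin _ ne) ?(notin _ j'i).
- by rewrite -/T; case: (n) => [|n'] /=; rewrite !mulSn ?mul0n /T; lia.
- by move=> _ M' [k' o']; split=> // j jn; apply: o'; lia.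
Qed.

(** * Orders of all curves *)

Definition output_order (i q : nat) (M : memory) : seq nat :=
  flatten (map (block M) (mkseq (M (KORDER i)) q)).

(** Costs are charged to emitted curves: a block with [rem] removed curves takes [7 + 4 * rem]
    steps, at most 7 per curve because it also contains its representative. *)
Lemma reinsert_spec i q M (out := output_order i q M) : uniq out ->
  runs (reinsert i q) M (1 + q + 7 * size out) (fun _ M' =>
    same_except [:: LAMBDA i] M M' /\
    forall t, t < size out -> M' (LAMBDA i) (nth 0 out t) = t).
Proof.
move=> uo.
set ks := mkseq (M (KORDER i)) q.
pose emitted pos M' := same_except [:: LAMBDA i] M M' /\
  forall t, t < pos -> M' (LAMBDA i) (nth 0 out t) = t.
(* Uniqueness of [out] ensures that a new write overwrites no earlier position. *)
have emit pos M' : pos < size out -> emitted pos M' ->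
    emitted pos.+1 (upd M' (LAMBDA i) (nth 0 out pos) pos).
  move=> pos_lt [s e]; split.
    by apply: same_except_trans s _; apply: same_except_write; rewrite inE.
  move=> t t_pos; rewrite updE nth_uniq //; last (by apply: leq_trans pos_lt; lia).
  by case: eqP => [->//|ne]; apply: e; move: t_pos ne; clear; lia.
pose base p := size (flatten (map (block M) (take p ks))).
pose I p pos M' := pos = base p /\ emitted pos M'.
pose T p := 7 * size (block M (M (KORDER i) p)).
have sumT : \sum_(0 <= p < 0 + q) T p = 7 * size out.
  rewrite -big_distrr /= /out /output_order size_flatten sumnE !big_map.
  by rewrite add0n /index_iota subn0.
rewrite -sumT -[1 + q]/q.+1.
apply: (@runs_weaken _ _ _ (q.+1 + \sum_(0 <= p < 0 + q) T p) _ (I (0 + q))).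
- apply: (@runs_for_up _ _ _ I); first by split; rewrite // /base take0.
  move=> p pos M1 pq [-> [s1 e1]].
  have szk : p < size ks by rewrite size_mkseq; lia.
  have outE : out = flatten (map (block M) (take p ks)) ++
      block M (M (KORDER i) p) ++ flatten (map (block M) (drop p.+1 ks)).
    rewrite /out /output_order -/ks -[in LHS](cat_take_drop p ks) (drop_nth 0) //.
    by rewrite map_cat flatten_cat /= nth_mkseq //; lia.
  have baseS : base p.+1 = base p + size (block M (M (KORDER i) p)).
    rewrite /base (take_nth 0) // map_rcons flatten_rcons size_cat nth_mkseq //; lia.
  have nth_out x : x < size (block M (M (KORDER i) p)) ->
      nth 0 out (base p + x) = nth 0 (block M (M (KORDER i) p)) x.
    by move=> xb; rewrite outE nth_cat ltnNge leq_addr addKn nth_cat xb.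
  have szout : base p + size (block M (M (KORDER i) p)) <= size out.
    by rewrite outE !size_cat -/(base p); lia.
  apply: runs_read_bind; first by rewrite /T size_rcons.
  rewrite s1 //; move: nth_out szout baseS; rewrite /T.
  set r := M (KORDER i) p => nth_out szout baseS.
  have szb : size (block M r) = (M LAST r - (M FIRST r).+1).+1.
    by rewrite size_rcons size_map size_iota.
  do 2![apply: runs_read_bind; first by rewrite szb; lia].
  rewrite !s1 //; apply: runs_calc_bind; first by rewrite szb; lia.
  set lo := (M FIRST r).+1; set rem := M LAST r - lo.
  rewrite -/lo -/rem in szb.
  pose J j pos M' := pos = base p + (j - lo) /\ emitted pos M'.
  apply: (@runs_bind _ _ _ _ _ (1 + rem * 4) _ (J (lo + rem))).
  + apply: (@runs_for_up_const _ _ _ J); first by split; rewrite // subnn addn0.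
    move=> j pos' M2 j_lo [-> [s2 e2]].
    apply: runs_read_bind => //; rewrite s2 //; apply: runs_write_bind => //.
    apply: runs_calc => //; split; first lia.
    have := emit (base p + (j - lo)) M2; rewrite nth_out; last lia.
    rewrite nth_rcons size_map size_iota ifT; last by rewrite -/lo -/rem; lia.
    rewrite (nth_map 0) ?size_iota; last by rewrite -/lo -/rem; lia.
    rewrite nth_iota -/lo -/rem; last lia.
    by rewrite subnKC; [apply; [lia | split] | lia].
  + by rewrite szb; lia.
  move=> pos' M2 [-> e2]; rewrite addKn in e2 *.
  apply: runs_write_bind; first by rewrite szb; lia.
  apply: runs_calc; first by rewrite szb; lia.
  split; first by rewrite baseS szb addnS.
  have := emit (base p + rem) M2; rewrite nth_out; last lia.
  rewrite nth_rcons size_map size_iota ltnn eqxx; apply; last exact: e2.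
  lia.
- by [].
- move=> pos M' [-> [s e]]; split=> // t t_lt; apply: e.
  by rewrite /base add0n take_oversize ?size_mkseq.
Qed.

Lemma index_flatten (f : nat -> seq nat) ks s p :
  uniq (flatten (map f ks)) -> p < size ks -> s \in f (nth 0 ks p) ->
  index s (flatten (map f ks)) =
  size (flatten (map f (take p ks))) + index s (f (nth 0 ks p)).
Proof.
rewrite -{1 4}(cat_take_drop p ks) => + pk sf.
rewrite (drop_nth 0) // map_cat flatten_cat /= cat_uniq => /and3P[_ /hasPn nin _].
by rewrite index_cat (negbTE (nin s _)) ?mem_cat ?index_cat sf.
Qed.

Section Output.
Variables (n m q : nat) (M0 M1 M : memory).
Let K := mkseq (M1 KEPT) q.
Hypothesis ker : kernel n m q M0 M1.
Hypothesis bins01 : forall s, M1 (BINS s) =1 M0 (BINS s).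
Hypothesis same : same_kernel M1 M.
Hypothesis ord : forall j, j < n -> ordered n q j K M.

Lemma blockE r : block M r = block M1 r.
Proof.
case: same => _ so _ fi la; rewrite /block /removed_with fi la.
by rewrite (eq_map so).
Qed.

Lemma output_perm i : i < n -> perm_eq (output_order i q M) (iota 0 m).
Proof.
move=> lin; apply: perm_trans (kernel_blocks ker).
rewrite /output_order (eq_map blockE); apply/perm_flatten/perm_map.
exact: ordered_perm (ord lin).
Qed.

Lemma rep_exists s : s < m ->
  exists2 r, r \in K & s \in block M r /\ row_of n M0 s = row_of n M0 r.
Proof.
move=> sm; have: s \in flatten (map (block M1) K).
  by rewrite (perm_mem (kernel_blocks ker)) mem_iota.
move=> /flatten_mapP[r rK sr]; exists r => //; rewrite blockE; split=> //.
exact: kernel_same_row ker _ _ rK sr.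
Qed.

Lemma pos_kept i r : i < n -> r \in K ->
  let p := M (KPOS i) r in p < q /\ M (KORDER i) p = r.
Proof.
move=> lin; case: (ord lin) => perm pos _; rewrite -(perm_mem perm).
by move=> /mapP[p + ->]; rewrite mem_iota /= => pq; rewrite pos.
Qed.

Lemma index_output i r s : i < n -> r \in K -> s \in block M r ->
  index s (output_order i q M) =
  size (flatten (map (block M) (take (M (KPOS i) r) (mkseq (M (KORDER i)) q))))
  + index s (block M r).
Proof.
move=> lin rK sr; have [pq Kp] := pos_kept lin rK.
have nK : nth 0 (mkseq (M (KORDER i)) q) (M (KPOS i) r) = r by rewrite nth_mkseq.
rewrite /output_order (@index_flatten _ _ _ (M (KPOS i) r)) ?nK ?size_mkseq //.
by rewrite -/(output_order i q M) (perm_uniq (output_perm lin)) iota_uniq.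
Qed.

(** The right-hand side does not depend on [i]: curves with a common representative never cross. *)
Lemma index_output_same i r s s' : i < n -> r \in K ->
  s \in block M r -> s' \in block M r ->
  (index s (output_order i q M) < index s' (output_order i q M))
  = (index s (block M r) < index s' (block M r)).
Proof. by move=> lin rK sr s'r; rewrite !(index_output lin rK) // ltn_add2l. Qed.

Lemma index_output_lt i r r' s s' : i < n -> r \in K -> r' \in K ->
  s \in block M r -> s' \in block M r' -> M (KPOS i) r < M (KPOS i) r' ->
  index s (output_order i q M) < index s' (output_order i q M).
Proof.
move=> lin rK r'K sr s'r' lt_pos.
rewrite (index_output lin rK sr) (index_output lin r'K s'r').
have [pq Kp] := pos_kept lin rK; have [pq' _] := pos_kept lin r'K.
rewrite -(subnKC lt_pos) takeD map_cat flatten_cat size_cat.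
rewrite (take_nth 0) ?size_mkseq // map_rcons flatten_rcons size_cat.
rewrite nth_mkseq // Kp -!addnA ltn_add2l ltn_addr //.
by rewrite index_mem.
Qed.

Lemma index_output_bins i s s' : i < n -> s < m -> s' < m ->
  M0 (BINS s) i < M0 (BINS s') i ->
  index s (output_order i q M) < index s' (output_order i q M).
Proof.
move=> lin /rep_exists[r rK [sr rowr]] /rep_exists[r' r'K [s'r' rowr']] lt_b.
move: rowr rowr' => /mkseq_eqP rowr /mkseq_eqP rowr'.
rewrite rowr // rowr' // in lt_b.
apply: (index_output_lt lin rK r'K sr s'r'); apply: ordered_key (ord lin) _ _ rK r'K _.
case: same => bins _ _ _ _; rewrite /order_key_lt.
case: (eqVneq i 0) => [i0|i0]; last first.
  by rewrite ltxi_pair !leEnat !bins !bins01 ltnW // leqNgt lt_b.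
rewrite i0 in lin lt_b.
rewrite /row_of !(eq_mkseq (bins _)) !(eq_mkseq (bins01 _)).
by rewrite (ltxi_mkseq (x := 0)) // ltn_eqF.
Qed.

Lemma index_output_first j s s' : j < n -> s < m -> s' < m ->
  (forall x, x < j -> M0 (BINS s) x = M0 (BINS s') x) ->
  M0 (BINS s) j < M0 (BINS s') j ->
  index s (output_order 0 q M) < index s' (output_order 0 q M).
Proof.
move=> jn /rep_exists[r rK [sr rowr]] /rep_exists[r' r'K [s'r' rowr']] agree lt_b.
have n0 : 0 < n by lia.
apply: (index_output_lt n0 rK r'K sr s'r'); apply: ordered_key (ord n0) _ _ rK r'K _.
case: same => bins _ _ _ _; rewrite /order_key_lt eqxx.
rewrite /row_of !(eq_mkseq (bins _)) !(eq_mkseq (bins01 _)) -/(row_of n M0 r).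
rewrite -/(row_of n M0 r') -rowr -rowr'.
by rewrite (ltxi_mkseq (x := j)) // ltn_eqF.
Qed.

Lemma index_output_keep i s s' : i.+1 < n -> s < m -> s' < m ->
  M0 (BINS s) i.+1 = M0 (BINS s') i.+1 ->
  (index s (output_order i.+1 q M) < index s' (output_order i.+1 q M))
  = (index s (output_order i q M) < index s' (output_order i q M)).
Proof.
move=> in1 /rep_exists[r rK [sr rowr]] /rep_exists[r' r'K [s'r' rowr']] eq_b.
have lin := ltnW in1.
have [e|ne] := eqVneq r r'.
  by rewrite -e in s'r'; rewrite !(index_output_same _ rK).
move: rowr rowr' => /mkseq_eqP rowr /mkseq_eqP rowr'.
rewrite rowr // rowr' // in eq_b.
case: same => bins _ _ _ _.
(* [ordered_key] is only an implication; the equivalence comes from using it for both orders of the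
   pair. Equal positions are excluded because [KORDER] inverts [KPOS]. *)
have step x y : x \in K -> y \in K -> M0 (BINS x) i.+1 = M0 (BINS y) i.+1 ->
    M (KPOS i) x < M (KPOS i) y -> M (KPOS i.+1) x < M (KPOS i.+1) y.
  move=> xK yK e lt_xy; apply: ordered_key (ord in1) _ _ xK yK _.
  by rewrite /order_key_lt ltxi_pair !bins !bins01 e lexx.
case: (ltngtP (M (KPOS i) r) (M (KPOS i) r')) => lt_pos.
- rewrite (index_output_lt lin rK r'K) // (index_output_lt in1 rK r'K) //.
  exact: step.
- have lt0 := index_output_lt lin r'K rK s'r' sr lt_pos.
  have lt1 := index_output_lt in1 r'K rK s'r' sr (step _ _ r'K rK (esym eq_b) lt_pos).
  by rewrite !ltnNge (ltnW lt0) (ltnW lt1).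
- have [_ Kr] := pos_kept lin rK; have [_ Kr'] := pos_kept lin r'K.
  by rewrite -Kr -Kr' lt_pos eqxx in ne.
Qed.
End Output.

Lemma curve_order_of_output m n q M :
  (forall i, i < n -> perm_eq (output_order i q M) (iota 0 m)) ->
  exists L : curve_order m n,
    forall i s, L i s = index (s : nat) (output_order i q M) :> nat.
Proof.
move=> outs.
have lt_index (i : 'I_n) (s : 'I_m) : index (s : nat) (output_order i q M) < m.
  have p := outs i (ltn_ord i); rewrite -[m in _ < m](size_iota 0) -(perm_size p).
  by rewrite index_mem (perm_mem p) mem_iota /=.
have inj (i : 'I_n) : injective (fun s => Ordinal (lt_index i s)).
  move=> s s' /(congr1 val) /= e; apply: val_inj => /=.
  have p := outs i (ltn_ord i).
  have ltm (t : 'I_m) : (t : nat) \in output_order i q M.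
    by rewrite (perm_mem p) mem_iota /=.
  by rewrite -(nth_index 0 (ltm s)) e nth_index.
by exists (fun i => perm (inj i)) => i s; rewrite permE.
Qed.

Lemma output_min_crossings m n q k (B : 'M['I_k]_(m, n)) M0 M1 M
    (L : curve_order m n) :
  holds_input B M0 -> kernel n m q M0 M1 ->
  (forall s, M1 (BINS s) =1 M0 (BINS s)) -> same_kernel M1 M ->
  (forall j, j < n -> ordered n q j (mkseq (M1 KEPT) q) M) ->
  (forall i s, L i s = index (s : nat) (output_order i q M) :> nat) ->
  min_crossings B L.
Proof.
move=> input ker bins01 same ord LE.
apply: greedy_min_crossings => [i s s' lt_b|i j s s' ji eq_b|i j s s' i0 agree lt_b].
- by rewrite !LE; apply: (index_output_bins ker bins01 same ord); rewrite ?input.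
- rewrite !LE ji; apply: (index_output_keep ker bins01 same ord) => //.
    by rewrite -ji.
  by rewrite -ji !input eq_b.
- rewrite !LE i0; apply: (index_output_first ker bins01 same ord (j := j)) => //.
    by move=> x xj; rewrite -[x]/(val (Ordinal (ltn_trans xj (ltn_ord j)))) !input agree.
  by rewrite !input.
Qed.

Lemma ordered_output_perm n m q M0 M1 M :
  kernel n m q M0 M1 -> same_kernel M1 M ->
  (forall j, j < n -> ordered n q j (mkseq (M1 KEPT) q) M) ->
  forall i, i < n -> perm_eq (output_order i q M) (iota 0 m).
Proof. by move=> ker same ord i; apply: (output_perm ker same ord). Qed.

Lemma output_order_same i q M M' : same_kernel M M' ->
  M' (KORDER i) =1 M (KORDER i) -> output_order i q M' = output_order i q M.
Proof.
by move=> same ko; rewrite /output_order (eq_map (blockE same)) (eq_mkseq ko).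
Qed.

Lemma reinsert_all_spec n m q M :
  (forall i, i < n -> perm_eq (output_order i q M) (iota 0 m)) ->
  runs (for_up 0 n tt (fun i _ => reinsert i q ;; ret tt)) M
    (1 + n * (2 + q + 7 * m)) (fun _ M' =>
    forall i s, i < n -> s < m -> M' (LAMBDA i) s = index s (output_order i q M)).
Proof.
move=> outs.
pose I i (_ : unit) M' := (forall b, (forall j, b != LAMBDA j) -> M' b =1 M b) /\
  forall j s, j < i -> s < m -> M' (LAMBDA j) s = index s (output_order j q M).
apply: (@runs_weaken _ _ _ (1 + n * (1 + q + 7 * m).+1) _ (fun x => I (0 + n) x)).
- apply: (@runs_for_up_const _ _ _ I); first by split.
  move=> i x M1 lin [s1 o1]; have p := outs i lin.
  have outE : output_order i q M1 = output_order i q M.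
    by apply: output_order_same; [split=> * | ]; apply: s1.
  have uo : uniq (output_order i q M1) by rewrite outE (perm_uniq p) iota_uniq.
  have sz : size (output_order i q M1) = m.
    by rewrite outE (perm_size p) size_iota.
  apply: (runs_bind (reinsert_spec uo)); rewrite sz //.
  move=> _ M2 [s2 o2]; apply: runs_ret; split.
    by move=> b bL y; rewrite s2 ?inE // s1.
  move=> j s ji sm; have [ej|ne] := eqVneq j i.
    have so : s \in output_order i q M1 by rewrite outE (perm_mem p) mem_iota.
    rewrite ej -outE -[in LHS](nth_index 0 so) o2 // -sz index_mem //.
  rewrite s2 ?o1 //; first lia.
  by rewrite inE; apply/eqP => -[e]; rewrite e eqxx in ne.
- by lia.
- by move=> _ M' [_ o].
Qed.

(** * Assembly of the phases and the total running time *)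

Lemma kernel_leq n m q M0 M : kernel n m q M0 M -> q <= m.
Proof.
move=> ker; rewrite -[q](size_mkseq (M KEPT)) -[m in _ <= m](size_iota 0).
apply: uniq_leq_size => [|x xK]; first exact: map_uniq (kernel_distinct_rows ker).
rewrite -(perm_mem (kernel_blocks ker)); apply/flatten_mapP; exists x => //.
by rewrite mem_rcons mem_head.
Qed.

Definition kernelize_time (n m l : nat) : nat :=
  m.*2 + 5 + m * (2 * (l * (10 + 2 * (4 * n + 5))) + 10) + (1 + m * (4 * n + 10)).

Definition order_time (n m l : nat) : nat :=
  n.+1 * (8 + m * 6 + m * (2 * (l * (10 + 2 * 6)) + 10))
  + m * (2 * (l * (10 + 2 * (4 * n + 5))) + 10).

Definition reinsert_time (n m : nat) : nat := 1 + n * (2 + m + 7 * m).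

Lemma curve_ordering_spec m n k l (B : 'M['I_k]_(m, n)) M :
  holds_input B M -> m < 2 ^ l ->
  runs (curve_ordering n m) M
    (kernelize_time n m l + order_time n m l + reinsert_time n m)
    (fun _ M' => exists L : curve_order m n, holds_output L M' /\ min_crossings B L).
Proof.
move=> input ml; apply: (runs_bind (kernelize_spec n M ml)).
  by rewrite -/(kernelize_time n m l); lia.
move=> q M1 [s1 ker]; have qm := kernel_leq ker.
have uK : uniq (mkseq (M1 KEPT) q) by exact: map_uniq (kernel_distinct_rows ker).
have ql : q < 2 ^ l by apply: leq_ltn_trans ml.
have le_time : order_time n q l <= order_time n m l.
  by rewrite /order_time !(leq_add, leq_mul).
rewrite -/(kernelize_time n m l); apply: runs_bindA.
apply: (runs_bind (order_all_spec n uK ql)).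
  by rewrite -/(order_time n q l); lia.
rewrite -/(order_time n q l) => _ M2 [same ord].
have outs := ordered_output_perm ker same ord.
apply: (runs_weaken (reinsert_all_spec outs)).
  have: n * (2 + q + 7 * m) <= n * (2 + m + 7 * m).
    by rewrite leq_mul // leq_add2r leq_add2l.
  by rewrite /reinsert_time; lia.
move=> _ M3 out; have [L LE] := curve_order_of_output outs.
exists L; split; first by move=> i s; rewrite out // LE.
apply: (output_min_crossings input ker _ same ord LE) => s; exact: s1.
Qed.

(** The left side is a polynomial of degree at most one in each of [n], [m], [l] with nonnegative
    coefficients, so each monomial is at most [n * m * l]. The coefficients sum to 501, the value at
    [n = m = l = 1]; 600 leaves some slack. *)
Lemma curve_ordering_time_leq n m l : 0 < n -> 0 < m -> 0 < l ->
  kernelize_time n m l.+1 + order_time n m l.+1 + reinsert_time n m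
  <= 600 * (n * m * l).
Proof.
rewrite /kernelize_time /order_time /reinsert_time.
case: n => // n; case: m => // m; case: l => // l _ _ _.
nia.
Qed.

Theorem theorem1 :
  (forall (R : realFieldType) (m n k : nat)
      (U : uncertain_set_system R m n k) (B : 'M['I_k]_(m, n)) (M : memory),
    encodes U B -> holds_input B M ->
    exists L : curve_order m n,
      holds_output L (final_memory (curve_ordering n m M)) /\
      min_crossings B L) /\
  (exists C : nat,
    forall (R : realFieldType) (m n k : nat)
      (U : uncertain_set_system R m n k) (B : 'M['I_k]_(m, n)) (M : memory),
    0 < n -> 1 < m -> encodes U B -> holds_input B M ->
    time (curve_ordering n m M) <= C * (n * m * trunc_log 2 m)).
Proof.
(* Here [l] is [(trunc_log 2 m).+1], the rounding that makes [m < 2 ^ l] hold for every [m]. *)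
have spec m n k (B : 'M['I_k]_(m, n)) M (input : holds_input B M) :=
  curve_ordering_spec input (trunc_log_ltn m (ltnSn 1)).
split=> [R m n k _ B M _ /spec[] //|].
exists 600 => R m n k _ B M n0 m1 _ /spec[_ /leq_trans-> //].
(* [1 < m] makes the logarithm positive, so that it absorbs the successor in [l] and the terms
   without a logarithm. *)
by apply: curve_ordering_time_leq; rewrite // ?(ltnW m1) // trunc_log_gt0.
Qed.
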